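(* Let $k\ge1$ be an integer, $\mathbf f\in[L^2(\Omega)]^d$ and $\widehat{\mathbf u}\in[L^2(\Gamma)]^d$. Consider the following two discrete problems. (P) Find $\mathbf u_h=\{\mathbf u_0,\mathbf u_b\}\in V_h$ with $\mathbf u_b=Q_b\widehat{\mathbf u}$ on $\Gamma$ such that $a_s(\mathbf u_h,\mathbf v)=(\mathbf f,\mathbf v_0)$ for all $\mathbf v=\{\mathbf v_0,\mathbf v_b\}\in V_h^0$. (M) Find $\mathbf u_h=\{\mathbf u_0,\mathbf u_b\}\in V_h$ and $p_h\in W_h$ with $\mathbf u_b=Q_b\widehat{\mathbf u}$ on $\Gamma$ and $(\lambda^{-1}p_h,1)=\int_\Gamma\widehat{\mathbf u}\cdot\mathbf n\,ds$ such that $$a(\mathbf u_h,\mathbf v)+b(\mathbf v,p_h)=(\mathbf f,\mathbf v_0)\quad\forall\,\mathbf v\in V_h^0,\qquad b(\mathbf u_h,q)-\lambda^{-1}(p_h,q)=0\quad\forall\, q\in W_h^0 .$$ Then (P) and (M) are equivalent in the sense that their solutions $\mathbf u_h$ are identical: $\mathbf u_h\in V_h$ solves (P) if and only if there is $p_h\in W_h$ such that $(\mathbf u_h;p_h)$ solves (M).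
   Context: Domain and partition. $\Omega\subset\mathbb R^d$, $d\in\{2,3\}$, is a bounded connected open polygonal ($d=2$) or polyhedral ($d=3$) domain with Lipschitz boundary $\Gamma=\partial\Omega$. $\mathcal T_h$ is a finite partition of $\Omega$ into polygons ($d=2$) or polyhedra ($d=3$); $h_T$ is the diameter of $T\in\mathcal T_h$ and $h=\max_T h_T$; $\mathcal E_h$ is the set of all edges ($d=2$) or flat faces ($d=3$). Each $e\in\mathcal E_h$ either lies on $\Gamma$ or is shared by two elements. $\mathbf n$ is the unit outward normal on $\partial T$ or $\Gamma$. $(\cdot,\cdot)$, $(\cdot,\cdot)_T$, $\langle\cdot,\cdot\rangle_{\partial T}$ are the $L^2$ inner products on $\Omega$, $T$, $\partial T$ (scalar, vector or matrix valued). Shape regularity. $\mathcal T_h$ is shape regular: there are constants $\rho_v,\rho_e,\kappa,\sigma^*,\gamma_*>0$ and $\theta_0<\pi/2$ such that for every $T\in\mathcal T_h$ and every edge/face $e$ of $T$ with diameter $h_e$: (i) $\rho_v h_T^d\le|T|$ and $\rho_e h_e^{d-1}\le|e|$; (ii) $\kappa h_T\le h_e$; (iii) $T$ contains a pyramid with base $e$, apex $A_e\in T$ and height $\sigma_e h_T$ with $\sigma_e\ge\sigma^*$, such that for all $x_e\in e$ the angle between $x_e-A_e$ and the outward normal of $e$ lies in $[0,\theta_0]$; (iv) $T$ has a circumscribed shape-regular simplex $S(T)$ of diameter at most $\gamma_*h_T$, and each $S(T)$ intersects only a bounded number of the other $S(T')$. Spaces. $P_r(D)$ denotes polynomials of degree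 at most $r$ on $D$. $\mathsf{RM}(T)=\{\mathbf a+\eta\mathbf x:\mathbf a\in\mathbb R^d,\ \eta\in\mathbb R^{d\times d}\text{ skew-symmetric}\}$, and $P_{RM}(e)$ is the space of restrictions to $e$ of functions in $\mathsf{RM}(T)$. Put $V_{k-1}(e)=[P_{k-1}(e)]^d+P_{RM}(e)$ (so it is $[P_{k-1}(e)]^d$ for $k>1$ and $P_{RM}(e)$ for $k=1$). $V_h$ is the space of pairs $\mathbf v=\{\mathbf v_0,\mathbf v_b\}$ with $\mathbf v_0|_T\in[P_k(T)]^d$ for each $T\in\mathcal T_h$ and $\mathbf v_b|_e\in V_{k-1}(e)$ for each $e\in\mathcal E_h$ ($\mathbf v_b$ single valued on each $e$, not required to be the trace of $\mathbf v_0$). $V_h^0=\{\mathbf v\in V_h:\mathbf v_b=0\text{ on }\Gamma\}$. $W_h=\{q:q|_T\in P_{k-1}(T)\ \forall T\in\mathcal T_h\}$ and $W_h^0=\{q\in W_h:\int_\Omega q\,dx=0\}$. $Q_b$ is, on each $e$, the $L^2$ projection onto $V_{k-1}(e)$. Discrete weak operators. For $\mathbf v\in V_h$ and $T\in\mathcal T_h$, $\nabla_w\cdot\mathbf v|_T\in P_{k-1}(T)$ and $\nabla_w\mathbf v|_T\in[P_{k-1}(T)]^{d\times d}$ are defined by $(\nabla_w\cdot\mathbf v,\phi)_T=-(\mathbf v_0,\nabla\phi)_T+\langle\mathbf v_b\cdot\mathbf n,\phi\rangle_{\partial T}$ for all $\phi\in P_{k-1}(T)$, and $(\nabla_w\mathbf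 v,\varphi)_T=-(\mathbf v_0,\nabla\cdot\varphi)_T+\langle\mathbf v_b,\varphi\mathbf n\rangle_{\partial T}$ for all $\varphi\in[P_{k-1}(T)]^{d\times d}$ (divergence row-wise). $\varepsilon_w(\mathbf v)=\frac12(\nabla_w\mathbf v+(\nabla_w\mathbf v)^T)$. Bilinear forms. With Lamé constants $\mu>0$, $\lambda>0$, $s(\mathbf w,\mathbf v)=\sum_{T}h_T^{-1}\langle Q_b\mathbf w_0-\mathbf w_b,Q_b\mathbf v_0-\mathbf v_b\rangle_{\partial T}$, $a(\mathbf w,\mathbf v)=\sum_T2\mu(\varepsilon_w(\mathbf w),\varepsilon_w(\mathbf v))_T+s(\mathbf w,\mathbf v)$, $a_s(\mathbf w,\mathbf v)=a(\mathbf w,\mathbf v)+\sum_T\lambda(\nabla_w\cdot\mathbf w,\nabla_w\cdot\mathbf v)_T$, $b(\mathbf v,q)=\sum_T(\nabla_w\cdot\mathbf v,q)_T$. *)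

(* Defs.v *)
From HB Require Import structures.
From mathcomp Require Import all_boot all_order all_algebra.
From mathcomp Require Import all_classical all_reals all_analysis.

Set Implicit Arguments.
Unset Strict Implicit.
Unset Printing Implicit Defensive.

Import Order.TTheory GRing.Theory Num.Theory.
Import numFieldNormedType.Exports.

Local Open Scope classical_set_scope.
Local Open Scope ring_scope.

Definition measure_rV_display : measure_display.
Proof. exact: default_measure_display. Qed.

Section measurable_rV.
Context (R : realType) (n : nat).

(* the product sigma-algebra, which is the Borel one *)
Let coords : 'I_n -> 'rV[R]_n -> measurableTypeR R := fun i x => x 0 i.

Let rV_set0 : g_sigma_preimage coords set0.
Proof. exact: sigma_algebra0. Qed.

Let rV_setC A : g_sigma_preimage coords A -> g_sigma_preimage coords (~` A).
Proof. exact: sigma_algebraC. Qed.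

Let rV_bigcup (F : _^nat) : (forall i, g_sigma_preimage coords (F i)) ->
  g_sigma_preimage coords (\bigcup_i (F i)).
Proof. exact: sigma_algebra_bigcup. Qed.

HB.instance Definition _ := @isMeasurable.Build measure_rV_display
  'rV[R]_n (g_sigma_preimage coords) rV_set0 rV_setC rV_bigcup.

End measurable_rV.

Section lebesgue_rV.
Context (R : realType).

Definition consv (n : nat) (p : R * 'rV[R]_n) : 'rV[R]_n.+1 :=
  \row_i if unlift ord0 i is Some j then p.2 0 j else p.1.

Lemma measurable_coord (n : nat) (i : 'I_n) :
  measurable_fun [set: 'rV[R]_n] (fun x : 'rV[R]_n => x 0 i).
Proof.
move=> _ Y mY; rewrite setTI; apply: sub_sigma_algebra => /=.
rewrite -bigcup_seq/=; exists i => /=; first by rewrite mem_index_enum.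
by exists Y => //; rewrite setTI.
Qed.

Lemma measurable_rVP d (T : measurableType d) (n : nat) (f : T -> 'rV[R]_n) :
  (forall i, measurable_fun [set: T] (fun x => f x 0 i)) ->
  measurable_fun [set: T] f.
Proof.
move=> mf _ Y mY; rewrite setTI.
have : preimage_set_system [set: T] f measurable (f @^-1` Y).
  by exists Y => //; rewrite setTI.
rewrite /measurable/= -g_sigma_preimage_comp; apply: smallest_sub.
  exact: sigma_algebra_measurable.
rewrite -bigcup_seq; apply: bigcup_sub => i _ A [B mB <-].
by apply: mf => //.
Qed.

Lemma measurable_consv (n : nat) :
  measurable_fun [set: R * 'rV[R]_n] (@consv n).
Proof.
apply: measurable_rVP => i; rewrite /consv.
under eq_fun do rewrite mxE.
case: (unlift ord0 i) => [j|]; last exact: measurable_fst.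
apply: (@measurableT_comp _ _ _ _ _ _ (fun x : 'rV[R]_n => x 0 j)).
  exact: measurable_coord.
exact: measurable_snd.
Qed.


Section step.
Context (n : nat) (m : {sigma_finite_measure set 'rV[R]_n -> \bar R}).

Definition lebS : set 'rV[R]_n.+1 -> \bar R :=
  pushforward ((@lebesgue_measure R) \x m)%E (@consv n).


Let lebS0 : lebS set0 = 0%E.
Proof. by rewrite /lebS /pushforward preimage_set0 measure0. Qed.

Let lebS_ge0 A : (0 <= lebS A)%E.
Proof. by rewrite /lebS /pushforward measure_ge0. Qed.

Let lebS_sigma_additive : semi_sigma_additive lebS.
Proof.
exact: (@measure_semi_sigma_additive _ _ _
  (measure_function_pushforward__canonical__measure_function_Measure
     ((@lebesgue_measure R) \x m)%E (@measurable_consv n))).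
Qed.

HB.instance Definition _ := isMeasure.Build _ _ _ lebS
  lebS0 lebS_ge0 lebS_sigma_additive.

Let unconsv (x : 'rV[R]_n.+1) : R * 'rV[R]_n := (x 0 ord0, \row_i x 0 (lift ord0 i)).

Let unconsvK : cancel (@consv n) unconsv.
Proof.
case=> t y; rewrite /unconsv /consv !mxE unlift_none; congr pair.
by apply/rowP => i; rewrite !mxE liftK.
Qed.

Let measurable_unconsv : measurable_fun setT unconsv.
Proof.
apply: measurable_fun_pair; first exact: measurable_coord.
apply: measurable_rVP => i; under eq_fun do rewrite mxE.
exact: measurable_coord.
Qed.

Let lebS_sigma_finite : sigma_finite setT lebS.
Proof.
have /sigma_finiteP[F [TF ndF Foo]] := sigma_finiteT (@lebesgue_measure R).
have /sigma_finiteP[G [TG ndG Goo]] := sigma_finiteT m.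
exists (fun k => unconsv @^-1` (F k `*` G k)).
  rewrite -preimage_bigcup; apply/seteqP; split=> // x _.
  have [k _ Fk] : (\bigcup_i F i) (unconsv x).1 by rewrite -TF.
  have [l _ Gl] : (\bigcup_i G i) (unconsv x).2 by rewrite -TG.
  exists (maxn k l) => //; split.
  - by move: Fk; exact/subsetPset/ndF/leq_maxl.
  - by move: Gl; exact/subsetPset/ndG/leq_maxr.
move=> k; have [mF mFoo] := Foo k; have [mG mGoo] := Goo k; split.
  rewrite -[X in measurable X]setTI; apply: measurable_unconsv => //.
  exact: measurableX.
rewrite /lebS /pushforward -comp_preimage.
have -> : unconsv \o @consv n = id by apply/funext => p /=; rewrite unconsvK.
by rewrite preimage_id product_measure1E// lte_mul_pinfty// ge0_fin_numE.
Qed.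

HB.instance Definition _ := Measure_isSigmaFinite.Build _ _ _ lebS
  lebS_sigma_finite.

End step.

Fixpoint leb (n : nat) : {sigma_finite_measure set 'rV[R]_n -> \bar R} :=
  if n is n'.+1 then lebS (leb n') else \d_(0 : 'rV[R]_0).

End lebesgue_rV.

Section geometry.
Context {R : realType}.

(* The library norm on 'rV[R]_n is the sup norm; it induces the usual topology
   but lengths and diameters need the Euclidean norm. *)
Definition dotv n (u v : 'rV[R]_n) : R := \sum_i u 0 i * v 0 i.
Definition enorm n (u : 'rV[R]_n) : R := Num.sqrt (dotv u u).
Definition angle n (u v : 'rV[R]_n) : R :=
  acos (dotv u v / (enorm u * enorm v)).
Definition diam n (A : set 'rV[R]_n) : R :=
  sup [set enorm (x - y) | x in A & y in A].
Definition frontier n (A : set 'rV[R]_n) : set 'rV[R]_n :=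
  closure A `\` interior A.

Definition in_hyperplanes n (A : set 'rV[R]_n) : Prop :=
  exists s : seq ('rV[R]_n * R), (forall h, h \in s -> h.1 != 0) /\
    forall x, A x -> exists2 h, h \in s & dotv x h.1 = h.2.

(* Closed polygons (n = 2), polyhedra (n = 3) and, for n = 1, segments; they
   need not be convex. *)
Definition polytope n (A : set 'rV[R]_n) : Prop :=
  [/\ closure (interior A) = A, bounded_set A, interior A !=set0,
      connected (interior A) & in_hyperplanes (frontier A)].

(* Near each boundary point, the set is the region lying below the graph of a
   Lipschitz function in some direction nu; the graph is over the hyperplane
   orthogonal to nu, i.e. phi does not depend on the nu-component. *)
Definition lipschitz_boundary n (A : set 'rV[R]_n) : Prop :=
  forall x0, frontier A x0 -> exists (nu : 'rV[R]_n) (phi : 'rV[R]_n -> R),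
    [/\ enorm nu = 1,
        (exists L, forall x y, `|phi x - phi y| <= L * enorm (x - y)),
        forall x t, phi (x + t *: nu) = phi x &
        \forall x \near x0, A x <-> dotv x nu < phi x].

Definition polytopal_domain n (Om : set 'rV[R]_n) : Prop :=
  [/\ Om !=set0, open Om, connected Om, bounded_set Om &
      in_hyperplanes (frontier Om) /\ lipschitz_boundary Om].

(* nu is the unit outward normal at the flat boundary point x of the closed
   set A: near x, A is the half-space (y - x) . nu <= 0 *)
Definition outward_normal n (A : set 'rV[R]_n) (x nu : 'rV[R]_n) : Prop :=
  enorm nu = 1 /\ \forall y \near x, A y <-> dotv (y - x) nu <= 0.

Definition conv_hull n m (P : 'I_m -> 'rV[R]_n) : set 'rV[R]_n :=
  [set x | exists t : 'I_m -> R,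
     [/\ forall j, 0 <= t j, \sum_j t j = 1 & x = \sum_j t j *: P j]].
Definition simplex n (S : set 'rV[R]_n) : Prop :=
  exists2 P : 'I_n.+1 -> 'rV[R]_n, S = conv_hull P &
    row_free (\matrix_j (P (lift ord0 j) - P ord0)).
Definition shape_regular_simplex n (c : R) (S : set 'rV[R]_n) : Prop :=
  simplex S /\
  exists x0, [set x | enorm (x - x0) <= c * diam S] `<=` S.

Definition pyramid n (e : set 'rV[R]_n) (A : 'rV[R]_n) : set 'rV[R]_n :=
  [set y | exists (x : 'rV[R]_n) (t : R),
     [/\ e x, 0 <= t <= 1 & y = A + t *: (x - A)]].

End geometry.

Section mesh.
Context {R : realType} {d : nat}.
Local Notation X := 'rV[R]_d.
Local Notation Y := 'rV[R]_d.-1.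

(* A flat (d-1)-dimensional face, given by an isometric parametrization
   y |-> org + y *m dir of a polytope of R^(d-1); the surface measure on the
   face is the image of the Lebesgue measure of R^(d-1) and does not depend on
   the parametrization. *)
Record facet := Facet {
  fdom : set Y;
  forg : X;
  fdir : 'M[R]_(d.-1, d);
  fdom_polytope : polytope fdom;
  fdir_isometric : fdir *m fdir^T = 1%:M }.

Definition fchart (e : facet) (y : Y) : X := forg e + y *m fdir e.
Definition face_set (e : facet) : set X := fchart e @` fdom e.
Definition relint (e : facet) : set X := fchart e @` interior (fdom e).
Definition farea (e : facet) : \bar R := leb R d.-1 (fdom e).
Definition fint (e : facet) (g : X -> R) : R :=
  \int[leb R d.-1]_(y in fdom e) g (fchart e y).

Definition face_of (A : set X) (e : facet) : Prop :=
  face_set e `<=` frontier A /\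
  exists nu, forall x, relint e x -> outward_normal A x nu.

(* A face has a single outward normal, see face_of. *)
Definition normal (A : set X) (e : facet) : X :=
  xget 0 [set nu | forall x, relint e x -> outward_normal A x nu].

Record mesh (Om : set X) := Mesh {
  elt : finType;
  face : finType;
  cell : elt -> set X;
  facetof : face -> facet;
  cell_polytope : forall T, polytope (cell T);
  cell_disjoint : forall T T', T != T' ->
    interior (cell T) `&` interior (cell T') = set0;
  cell_cover : \bigcup_T cell T = closure Om;
  face_disjoint : forall e e', e != e' ->
    relint (facetof e) `&` face_set (facetof e') = set0;
  cell_frontier : forall T,
    frontier (cell T) =
    \bigcup_(e in [set e | face_of (cell T) (facetof e)]) face_set (facetof e);
  (* each face lies on the boundary, and belongs to one element, or is shared
     by two elements *)
  face_owners : forall e,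
    (face_set (facetof e) `<=` frontier Om /\
       #|[set T | `[< face_of (cell T) (facetof e) >]]%SET| = 1%N) \/
    (~ face_set (facetof e) `<=` frontier Om /\
       #|[set T | `[< face_of (cell T) (facetof e) >]]%SET| = 2%N) }.

Context {Om : set X} (M : mesh Om).
Implicit Types (T : elt M) (e : face M).

Definition bface e : bool := `[< face_set (facetof e) `<=` frontier Om >].
Definition eface T e : bool := `[< face_of (cell T) (facetof e) >].

Definition hT T : R := diam (cell T).
Definition he e : R := diam (face_set (facetof e)).
Definition nT T e : X := normal (cell T) (facetof e).
Definition nGamma e : X := normal (closure Om) (facetof e).

Definition shape_regular : Prop :=
  exists rv re kappa sigma gamma theta c : R, exists N : nat,
  [/\ [/\ 0 < rv, 0 < re & 0 < kappa],
      [/\ 0 < sigma, 0 < gamma, theta < pi / 2 & 0 < c],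
      forall T, ((rv * hT T ^+ d)%:E <= leb R d (cell T))%E,
      forall T e, eface T e ->
        [/\ ((re * he e ^+ d.-1)%:E <= farea (facetof e))%E,
            kappa * hT T <= he e &
            exists (A : X) (sig : R),
              [/\ cell T A, pyramid (face_set (facetof e)) A `<=` cell T,
                  sigma <= sig &
                  forall x, face_set (facetof e) x ->
                    dotv (x - A) (nT T e) = sig * hT T /\
                    0 <= angle (x - A) (nT T e) <= theta]] &
      exists S : elt M -> set X, forall T,
        [/\ cell T `<=` S T, shape_regular_simplex c (S T),
            diam (S T) <= gamma * hT T &
            (#|[set T' | (T' != T) &&
                 `[< S T `&` S T' !=set0 >]]%SET| <= N)%N]].

End mesh.

Section weak_galerkin.
Context {R : realType} {d : nat}.
Local Notation X := 'rV[R]_d.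

(* polynomials of total degree at most r, as functions on R^d *)
Definition is_poly (r : nat) (p : X -> R) : Prop :=
  exists c : {ffun 'I_d -> 'I_r.+1} -> R, forall x,
    p x = \sum_(m : {ffun 'I_d -> 'I_r.+1} | (\sum_i m i <= r)%N)
            c m * \prod_i x 0 i ^+ m i.
Definition is_poly_vec (r : nat) (p : X -> X) : Prop :=
  forall i, is_poly r (fun x => p x 0 i).
Definition is_poly_mx (r : nat) (p : X -> 'M[R]_d) : Prop :=
  forall i j, is_poly r (fun x => p x i j).

(* matrices act on column vectors, hence the transpose *)
Definition rigid_motion (r : X -> X) : Prop :=
  exists (a : X) (eta : 'M[R]_d), eta^T = - eta /\
    forall x, r x = a + x *m eta^T.

Definition partial (i : 'I_d) (p : X -> R) (x : X) : R :=
  'D_(delta_mx 0 i : X) p x.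
Definition grad (p : X -> R) (x : X) : X := \row_i partial i p x.
Definition rowdiv (p : X -> 'M[R]_d) (x : X) : X :=
  \row_i \sum_j partial j (fun y => p y i j) x.
Definition mxdot (A B : 'M[R]_d) : R := \sum_i \sum_j A i j * B i j.

Definition square_integrable n (D : set 'rV[R]_n) (g : 'rV[R]_n -> R) : Prop :=
  measurable_fun D g /\
  (leb R n).-integrable D (fun x => (g x ^+ 2)%:E).

Definition L2_domain (Om : set X) (g : X -> X) : Prop :=
  forall i, square_integrable Om (fun x => g x 0 i).

Context {Om : set X} (M : mesh Om).
Implicit Types (T : elt M) (e : face M) (k : nat).

(* the boundary is the union of the boundary faces *)
Definition L2_boundary (g : X -> X) : Prop :=
  forall e, bface e -> forall i,
    square_integrable (fdom (facetof e))
      (fun y => g (fchart (facetof e) y) 0 i).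

Definition cellint T (g : X -> R) : R := \int[leb R d]_(x in cell T) g x.
Definition faceint e (g : X -> R) : R := fint (facetof e) g.

(* V_{k-1}(e), up to values outside e *)
Definition Vface k e (g : X -> X) : Prop :=
  exists p r : X -> X, [/\ is_poly_vec k.-1 p, rigid_motion r &
    forall x, face_set (facetof e) x -> g x = p x + r x].

Definition Qb k e (g : X -> X) : X -> X :=
  xget (fun=> 0) [set q | Vface k e q /\ forall w, Vface k e w ->
    faceint e (fun x => dotv (q x) (w x)) =
    faceint e (fun x => dotv (g x) (w x))].

(* A polynomial on an element T is represented by the polynomial function on
   R^d extending it, which is unique since T has interior points; a piecewise
   polynomial on the mesh is a family indexed by the elements. *)
Record wfun := WFun { w0 : elt M -> X -> X; wb : face M -> X -> X }.
Definition pwfun := elt M -> X -> R.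

Definition Vh k (v : wfun) : Prop :=
  (forall T, is_poly_vec k (w0 v T)) /\ (forall e, Vface k e (wb v e)).
Definition Vh0 k (v : wfun) : Prop :=
  Vh k v /\ forall e, bface e -> forall x, face_set (facetof e) x -> wb v e x = 0.
Definition Wh k (q : pwfun) : Prop := forall T, is_poly k.-1 (q T).
Definition Wh0 k (q : pwfun) : Prop :=
  Wh k q /\ \sum_(T : elt M) cellint T (q T) = 0.

Definition wdiv k (v : wfun) T : X -> R :=
  xget (fun=> 0) [set g | is_poly k.-1 g /\ forall phi, is_poly k.-1 phi ->
    cellint T (fun x => g x * phi x) =
    - cellint T (fun x => dotv (w0 v T x) (grad phi x)) +
    \sum_(e | eface T e)
       faceint e (fun x => dotv (wb v e x) (nT T e) * phi x)].

Definition wgrad k (v : wfun) T : X -> 'M[R]_d :=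
  xget (fun=> 0) [set g | is_poly_mx k.-1 g /\
    forall phi, is_poly_mx k.-1 phi ->
    cellint T (fun x => mxdot (g x) (phi x)) =
    - cellint T (fun x => dotv (w0 v T x) (rowdiv phi x)) +
    \sum_(e | eface T e)
       faceint e (fun x => dotv (wb v e x) (nT T e *m (phi x)^T))].

Definition wstrain k (v : wfun) T (x : X) : 'M[R]_d :=
  2^-1 *: (wgrad k v T x + (wgrad k v T x)^T).

Definition form_s k (w v : wfun) : R :=
  \sum_(T : elt M) (hT T)^-1 * \sum_(e | eface T e)
    faceint e (fun x => dotv (Qb k e (w0 w T) x - wb w e x)
                             (Qb k e (w0 v T) x - wb v e x)).

Definition form_a k (mu : R) (w v : wfun) : R :=
  \sum_(T : elt M)
     2 * mu * cellint T (fun x => mxdot (wstrain k w T x) (wstrain k v T x))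
  + form_s k w v.

Definition form_as k (mu lam : R) (w v : wfun) : R :=
  form_a k mu w v +
  \sum_(T : elt M) lam * cellint T (fun x => wdiv k w T x * wdiv k v T x).

Definition form_b k (v : wfun) (q : pwfun) : R :=
  \sum_(T : elt M) cellint T (fun x => wdiv k v T x * q T x).

Definition load (f : X -> X) (v : wfun) : R :=
  \sum_(T : elt M) cellint T (fun x => dotv (f x) (w0 v T x)).

Definition pw_inner (p q : pwfun) : R :=
  \sum_(T : elt M) cellint T (fun x => p T x * q T x).

Definition boundary_data k (uhat : X -> X) (u : wfun) : Prop :=
  forall e, bface e -> forall x, face_set (facetof e) x ->
    wb u e x = Qb k e uhat x.

Definition boundary_flux (uhat : X -> X) : R :=
  \sum_(e : face M | bface e) faceint e (fun x => dotv (uhat x) (nGamma e)).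

Definition primal_solution k (mu lam : R) (f uhat : X -> X) (u : wfun) : Prop :=
  [/\ Vh k u, boundary_data k uhat u &
      forall v, Vh0 k v -> form_as k mu lam u v = load f v].

Definition mixed_solution k (mu lam : R) (f uhat : X -> X)
    (u : wfun) (p : pwfun) : Prop :=
  [/\ Vh k u /\ Wh k p, boundary_data k uhat u,
      pw_inner (fun T x => lam^-1 * p T x) (fun _ _ => 1) =
        boundary_flux uhat,
      forall v, Vh0 k v -> form_a k mu u v + form_b k v p = load f v &
      forall q, Wh0 k q -> form_b k u q - lam^-1 * pw_inner p q = 0].

End weak_galerkin.

(* Main.v *)
(* Eliminating the pressure: put p = lam * div_w u. Testing the definition of the
   weak divergence with 1 and summing over the elements, the fluxes through interior
   faces cancel because the two outward normals are opposite, and on a boundary face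
   the normal of the element is that of the domain, so the integral of div_w u is the
   flux of Q_b uhat, hence of uhat since constants belong to V_{k-1}(e). Conversely,
   this mean value extends the second mixed equation from W_h^0 to W_h, where it can
   be tested with div_w v. Since div_w and Q_b are chosen among the solutions of their
   defining equations, existence must be shown: it follows from finite dimension,
   because a polynomial whose square has zero integral over an element or a face
   vanishes there. *)

Require Import Defs.
From mathcomp Require Import all_boot all_order all_algebra.
From mathcomp Require Import all_classical all_reals all_analysis.
From mathcomp Require Import measurable_realfun.
From mathcomp Require Import ring lra.

Set Implicit Arguments.
Unset Strict Implicit.
Unset Printing Implicit Defensive.

Import Order.TTheory GRing.Theory Num.Theory.
Import numFieldNormedType.Exports.

Local Open Scope classical_set_scope.
Local Open Scope ring_scope.

(** * Lebesgue measure of open, closed and bounded sets of row vectors *)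

Section lebesgue_rV.
Context {R : realType}.

(** Written coordinatewise, a box is an intersection of preimages under coordinates, hence
    measurable, and its preimage under [consv] is a product. *)
Definition box n (x : 'rV[R]_n) (r : R) : set 'rV[R]_n :=
  [set y | forall i, ball (x 0 i) r (y 0 i)].

Lemma measurable_ball (x r : R) : measurable (ball x r : set (measurableTypeR R)).
Proof. by rewrite ball_itv; exact: measurable_itv. Qed.

Lemma measurable_box n (x : 'rV[R]_n) r : measurable (box x r).
Proof.
rewrite (_ : box x r = \big[setI/setT]_(i < n)
    ((fun y : 'rV[R]_n => y 0 i) @^-1` ball (x 0 i) r)).
  apply: bigsetI_measurable => i _; rewrite -[X in measurable X]setTI.
  exact: (@measurable_coord R n i measurableT _ (measurable_ball _ _)).
rewrite -bigcap_seq; apply/seteqP; split=> [y yb i _|y yb i]; first exact: yb.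
by apply: (yb i); rewrite /= mem_index_enum.
Qed.

(** The sigma-algebra is generated by the coordinates, so [U] is exhausted by the countably many
    boxes with rational center and radius [1/(N+1)] that it contains. *)
Lemma open_measurable_rV n (U : set 'rV[R]_n) : open U -> measurable U.
Proof.
move=> oU.
pose F (a : 'rV[rat]_n * nat) : set 'rV[R]_n :=
  let b := box (map_mx ratr a.1) a.2.+1%:R^-1 in
  [set y | b y /\ b `<=` U].
have -> : U = \bigcup_a F a.
  apply/seteqP; split=> [y Uy|y [a _ [ay]]]; last exact.
  have := oU; rewrite openE => /(_ _ Uy) /nbhs_ballP[e /= e0 eU].
  (* Half of [e] is spent on the distance from [y] to the rational center, half on the radius of the
     box. *)
  have [N _ /(_ N (leqnn N)) Ne] : \forall k \near \oo, k.+1%:R^-1 < e / 2.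
    have e2 : 0 < e / 2 by rewrite divr_gt0.
    exact: (near_infty_natSinv_lt (PosNum e2)).
  have q i : {q : rat | ball (y 0 i) N.+1%:R^-1 (ratr q)}.
    apply: cid; have /rat_in_itvoo[q] :
      y 0 i - N.+1%:R^-1 < y 0 i + N.+1%:R^-1.
      by rewrite ltrBlDr -addrA ltrDl addr_gt0// invr_gt0.
    by rewrite in_itv/= -ltr_distlC => ?; exists q.
  exists (\row_i sval (q i), N) => //; split=> [i|z bz].
    by rewrite !mxE; have := svalP (q i); exact: ball_sym.
  apply: eU; split=> // j i; rewrite ord1.
  have := bz i; rewrite !mxE/= => zi.
  rewrite [e]splitr; apply: (@ball_triangle _ _ (ratr (sval (q i)) : R)).
    exact: le_ball (ltW Ne) _ (svalP (q i)).
  exact: le_ball (ltW Ne) _ zi.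
apply: countable_bigcupT_measurable => [|-[q N]]; first exact: countableP.
rewrite /F/=; set b := box _ _; have mb : measurable b by exact: measurable_box.
(* The inclusion does not depend on the point, so [F] is either the box or empty. *)
have [bU|bU] := pselect (b `<=` U).
  by rewrite (_ : [set _ | _] = b)//; apply/seteqP; split=> y // [].
by rewrite (_ : [set _ | _] = set0)//; apply/seteqP; split=> y // [].
Qed.

Lemma closed_measurable_rV n (U : set 'rV[R]_n) : closed U -> measurable U.
Proof.
move=> cU; rewrite -[U]setCK; apply: measurableC; apply: open_measurable_rV.
exact: closed_openC.
Qed.

(** By induction on the dimension: the measure is that of an interval of length [2r] times that of a
    box of one dimension less, starting from a Dirac mass in dimension 0. *)
Lemma leb_box n (x : 'rV[R]_n) r : 0 < r ->
  [/\ measurable (box x r), (0 < leb R n (box x r))%E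
    & (leb R n (box x r) < +oo)%E].
Proof.
move=> r0; elim: n => [|n IH] in x *.
  have -> : box x r = setT by apply/seteqP; split=> // y _ [].
  by split=> //=; rewrite diracT ?lte01 ?ltry.
have [mb b0 boo] := IH (\row_i x 0 (lift ord0 i)).
set b' := box _ r in mb b0 boo.
have E : @consv R n @^-1` box x r = ball (x 0 ord0) r `*` b'.
  apply/seteqP; split=> [[t y] /= ty|[t y] /= [xt xy] i].
    split=> [|i] /=; first by have := ty ord0; rewrite /consv mxE unlift_none.
    by have := ty (lift ord0 i); rewrite /consv !mxE liftK.
  rewrite /consv mxE; case: unliftP => [j|] -> //.
  by have := xy j; rewrite mxE.
have EL : leb R n.+1 (box x r) = ((r *+ 2)%:E * leb R n b')%E.
  transitivity ((@lebesgue_measure R \x leb R n)%E (ball (x 0 ord0) r `*` b')).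
    by rewrite -E.
  have mB := measurable_ball (x 0 ord0) r.
  rewrite (product_measure1E _ _ mB mb).
  by rewrite -(lebesgue_measure_ball (x 0 ord0) (ltW r0)).
have r20 : (0 < (r *+ 2)%:E)%E by rewrite lte_fin pmulrn_lgt0.
split; first exact: measurable_box.
  by rewrite EL mule_gt0.
by rewrite EL lte_mul_pinfty ?ltW.
Qed.

Lemma leb_bounded n (A : set 'rV[R]_n) : measurable A -> bounded_set A ->
  (leb R n A < +oo)%E.
Proof.
move=> mA [K [_ AK]].
(* [bounded_set] bounds the norm by every number strictly above [K], such as [|K| + 1]; balls are
   open, hence one more unit. *)
have r0 : 0 < `|K| + 2 by rewrite ltr_wpDl.
have [mb _ boo] := @leb_box n 0 _ r0.
apply: le_lt_trans boo; apply: le_measure; rewrite ?inE// => x Ax i.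
have : ball (0 : 'rV[R]_n) (`|K| + 2) x.
  rewrite -ball_normE/= sub0r normrN.
  apply: (@le_lt_trans _ _ (`|K| + 1)); last by rewrite ltrD2l ltr1n.
  by apply: AK => //; rewrite (le_lt_trans (ler_norm K))// ltrDl.
by move=> [_ /(_ 0 i)].
Qed.

Lemma leb_open_gt0 n (U : set 'rV[R]_n) : open U -> U !=set0 ->
  (0 < leb R n U)%E.
Proof.
move=> oU [x Ux]; have := oU; rewrite openE => /(_ _ Ux) /nbhs_ballP[e /= e0 eU].
have [mb b0 _] := leb_box x e0.
apply: lt_le_trans b0 _; apply: le_measure; rewrite ?inE//.
  exact: open_measurable_rV.
by move=> y xy; apply: eU; split=> // i j; rewrite ord1.
Qed.

End lebesgue_rV.

(** * Polynomial functions without a degree bound *)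

Section polynomial_functions.
Context {R : realType}.

(** Analytic properties are proved by induction on this closure; the degree, recorded by [is_poly],
    matters only for membership in the discrete spaces. *)
Inductive polyfun n : ('rV[R]_n -> R) -> Prop :=
| polyfun_cst c : polyfun (fun=> c)
| polyfun_coord i : polyfun (fun x => x 0 i)
| polyfunD p q : polyfun p -> polyfun q -> polyfun (fun x => p x + q x)
| polyfunM p q : polyfun p -> polyfun q -> polyfun (fun x => p x * q x).

Lemma polyfun_sum n (I : Type) (r : seq I) (P : pred I) (p : I -> 'rV[R]_n -> R) :
  (forall i, P i -> polyfun (p i)) -> polyfun (fun x => \sum_(i <- r | P i) p i x).
Proof.
move=> pp; elim: r => [|i r IH].
  by under eq_fun do rewrite big_nil; exact: polyfun_cst.
have [Pi|/negPf Pi] := boolP (P i); under eq_fun do rewrite big_cons Pi.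
  by apply: polyfunD => //; exact: pp.
exact: IH.
Qed.

Lemma polyfun_prod n (I : Type) (r : seq I) (P : pred I) (p : I -> 'rV[R]_n -> R) :
  (forall i, P i -> polyfun (p i)) -> polyfun (fun x => \prod_(i <- r | P i) p i x).
Proof.
move=> pp; elim: r => [|i r IH].
  by under eq_fun do rewrite big_nil; exact: polyfun_cst.
have [Pi|/negPf Pi] := boolP (P i); under eq_fun do rewrite big_cons Pi.
  by apply: polyfunM => //; exact: pp.
exact: IH.
Qed.

Lemma polyfunX n (p : 'rV[R]_n -> R) m : polyfun p -> polyfun (fun x => p x ^+ m).
Proof.
move=> pp; elim: m => [|m IH].
  by under eq_fun do rewrite expr0; exact: polyfun_cst.
by under eq_fun do rewrite exprS; exact: polyfunM.
Qed.

Lemma polyfun_continuous n (p : 'rV[R]_n -> R) : polyfun p -> continuous p.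
Proof.
elim=> [c|i|{}p q _ cp _ cq|{}p q _ cp _ cq] x.
- exact: cst_continuous.
- exact: coord_continuous.
- exact: cvgD (cp x) (cq x).
- exact: cvgM (cp x) (cq x).
Qed.

Lemma polyfun_measurable n (p : 'rV[R]_n -> R) : polyfun p ->
  measurable_fun [set: 'rV[R]_n] p.
Proof.
elim=> [c|i|{}p q _ cp _ cq|{}p q _ cp _ cq].
- exact: measurable_cst.
- exact: measurable_coord.
- exact: measurable_funD.
- exact: measurable_funM.
Qed.

Lemma polyfun_bounded n (p : 'rV[R]_n -> R) (A : set 'rV[R]_n) : polyfun p ->
  bounded_set A -> exists K, forall x, A x -> `|p x| <= K.
Proof.
move=> pp [K [_ AK]]; elim: pp => [c|i|{}p q _ [b bp] _ [c cq]|{}p q _ [b bp] _ [c cq]].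
- by exists `|c|.
- exists (`|K| + 2) => x Ax.
  suff [_ /(_ 0 i)] : ball (0 : 'rV[R]_n) (`|K| + 2) x.
    by rewrite mxE -ball_normE/= sub0r normrN => /ltW.
  rewrite -ball_normE/= sub0r normrN.
  apply: (@le_lt_trans _ _ (`|K| + 1)); last by rewrite ltrD2l ltr1n.
  by apply: AK => //; rewrite (le_lt_trans (ler_norm K))// ltrDl.
- exists (b + c) => x Ax; apply: le_trans (ler_normD _ _) _.
  by rewrite lerD ?bp ?cq.
- by exists (b * c) => x Ax; rewrite normrM ler_pM ?bp ?cq.
Qed.

Lemma polyfun_derivable n (p : 'rV[R]_n -> R) x v : polyfun p -> derivable p x v.
Proof.
elim=> [c|i|{}p q _ cp _ cq|{}p q _ cp _ cq].
- exact: derivable_cst.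
- by apply: (derivable_mxP _ _ _).1; exact: derivable_id.
- exact: derivableD.
- exact: derivableM.
Qed.

Lemma polyfun_derive n (p : 'rV[R]_n -> R) v : polyfun p ->
  polyfun (fun x => 'D_v p x).
Proof.
elim=> [c|i|{}p q pp cp pq cq|{}p q pp cp pq cq].
- by under eq_fun do rewrite derive_cst; exact: polyfun_cst.
- rewrite (_ : (fun _ => _) = fun=> v 0 i); first exact: polyfun_cst.
  apply/funext => x; have := derive_mx (@derivable_id R 'rV[R]_n x v).
  by rewrite derive_id => /(congr1 (fun w : 'rV_n => w 0 i)); rewrite !mxE.
- rewrite (_ : (fun _ => _) = fun x => 'D_v p x + 'D_v q x); first exact: polyfunD.
  by apply/funext => x; rewrite -deriveD//; exact: polyfun_derivable.
- rewrite (_ : (fun _ => _) = fun x => p x * 'D_v q x + q x * 'D_v p x).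
    by apply: polyfunD; exact: polyfunM.
  by apply/funext => x; rewrite (@deriveM _ _ p q)//; exact: polyfun_derivable.
Qed.

Lemma polyfun_comp m n (p : 'rV[R]_n -> R) (h : 'rV[R]_m -> 'rV[R]_n) :
  (forall i, polyfun (fun y => h y 0 i)) -> polyfun p -> polyfun (p \o h).
Proof.
move=> ph; elim=> [c|i|{}p q _ cp _ cq|{}p q _ cp _ cq].
- exact: polyfun_cst.
- exact: ph.
- exact: polyfunD.
- exact: polyfunM.
Qed.

Lemma is_poly_polyfun d r (p : 'rV[R]_d -> R) : is_poly r p -> polyfun p.
Proof.
move=> [c pE]; rewrite (funext pE); apply: polyfun_sum => m _.
apply: polyfunM; first exact: polyfun_cst.
by apply: polyfun_prod => i _; apply: polyfunX; exact: polyfun_coord.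
Qed.

End polynomial_functions.

(** * Integrals of polynomials over polytopes *)

Section integrals.
Context {R : realType} (n : nat).
Implicit Types (A : set 'rV[R]_n) (g : 'rV[R]_n -> R).

Lemma polytope_closed A : polytope A -> closed A.
Proof. by case=> <- *; exact: closed_closure. Qed.

Lemma polytope_measurable A : polytope A -> measurable A.
Proof. by move=> /polytope_closed; exact: closed_measurable_rV. Qed.

Lemma polytope_lty A : polytope A -> (leb R n A < +oo)%E.
Proof.
by move=> pA; apply: leb_bounded; [exact: polytope_measurable|case: pA].
Qed.

Lemma polytope_gt0 A : polytope A -> (0 < leb R n A)%E.
Proof.
move=> pA; have [_ _ A0 _ _] := pA.
apply: lt_le_trans (leb_open_gt0 (open_interior A) A0) _.
apply: le_measure; rewrite ?inE; [|exact: polytope_measurable|exact: interior_subset].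
by apply: open_measurable_rV; exact: open_interior.
Qed.

Lemma polyfun_integrable A g : polytope A -> polyfun g ->
  (leb R n).-integrable A (EFin \o g).
Proof.
move=> pA pg; apply: measurable_bounded_integrable.
- exact: polytope_measurable.
- exact: polytope_lty.
- apply: measurable_funTS; exact: polyfun_measurable.
- have [_ bA _ _ _] := pA; have [K gK] := polyfun_bounded pg bA.
  exists K; split=> [|y Ky x Ax /=]; first exact: num_real.
  exact: le_trans (gK x Ax) (ltW Ky).
Qed.

(** A polytope is the closure of its interior, and the zero set of a continuous function is
    closed. *)
Lemma eq0_on_polytope A g : polytope A -> continuous g ->
  (forall x, interior A x -> g x = 0) -> forall x, A x -> g x = 0.
Proof.
move=> [Acl _ _ _ _] cg g0.
have : closed (g @^-1` [set 0]).
  by apply: closed_comp => [y _|]; [exact: cg|exact: closed_eq].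
move=> /closure_id cl; suff : A `<=` g @^-1` [set 0] by [].
by rewrite -Acl cl; apply: closure_subset => y; exact: g0.
Qed.

(* If g were nonzero at an interior point, it would be nonzero on a nonempty open
   set, which has positive measure. *)
Lemma Rintegral_eq0 A g : polytope A -> polyfun g -> (forall x, 0 <= g x) ->
  \int[leb R n]_(x in A) g x = 0 -> forall x, A x -> g x = 0.
Proof.
move=> pA pg g0 Ig; have mA := polytope_measurable pA.
apply: eq0_on_polytope => // [|x Ax]; first exact: polyfun_continuous.
have mg : measurable_fun A (EFin \o g).
  by apply/measurable_EFinP; apply: measurable_funTS; exact: polyfun_measurable.
have Ig0 : (\int[leb R n]_(x in A) `|(g x)%:E| = 0)%E.
  under eq_integral do rewrite gee0_abs ?lee_fin ?g0//.
  rewrite -[0%E]/(0%:E) -Ig /Rintegral fineK//.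
  exact: integrable_fin_num (polyfun_integrable pA pg).
have /= ae0 := (ae_eq_integral_abs (leb R n) mA mg).1 Ig0.
apply: contrapT => /eqP gx.
pose U := interior A `&` (g @^-1` [set t | t != 0]).
have oU : open U.
  apply: openI; first exact: open_interior.
  by apply: open_comp => [y _|]; [exact: polyfun_continuous|exact: open_neq].
have := leb_open_gt0 oU (ex_intro _ x (conj Ax gx)).
suff /negligibleP -> : (leb R n).-negligible U.
- by rewrite ltxx.
- exact: open_measurable_rV.
apply: negligibleS ae0 => y [Ay gy] /(_ (interior_subset Ay)) [] gy0.
by move: gy; rewrite /= gy0 eqxx.
Qed.

End integrals.

(** * Linear equations for a possibly degenerate bilinear form *)

Lemma scalar_sum (F : fieldType) (V : lmodType F) (f : V -> F) (n : nat)
    (a : 'I_n -> F) (b : 'I_n -> V) : scalar f ->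
  f (\sum_i a i *: b i) = \sum_i a i * f (b i).
Proof.
move=> lf; elim/big_rec2: _ => [|i y1 y2 _ <-]; last by rewrite lf.
(* Linearity at the factor -1 and zero vectors gives [f 0 = 0]. *)
by have := lf (-1) 0 0; rewrite scaleN1r addNr mulN1r addNr.
Qed.

(* The kernel of the Gram matrix of B consists of isotropic vectors, on which L
   vanishes, so the linear system for c is solvable although B may be degenerate. *)
Import VectorInternalTheory.

Lemma riesz (F : fieldType) (C : vectType F) (B : C -> C -> F) (L : C -> F) :
  (forall c, scalar (B c)) -> (forall c, scalar (B ^~ c)) -> scalar L ->
  (forall c, B c c = 0 -> L c = 0) -> exists c, forall c', B c c' = L c'.
Proof.
move=> lB rB lL BL; pose n := dim C.
pose b (i : 'I_n) : C := @r2v _ C (delta_mx 0 i).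
pose G := \matrix_(i < n, j < n) B (b i) (b j).
pose l := \row_(j < n) L (b j).
have r2vE (u : 'rV[F]_n) : @r2v _ C u = \sum_i u 0 i *: b i.
  rewrite {1}[u]row_sum_delta linear_sum; apply: eq_bigr => i _.
  by rewrite linearZ.
have LE (u : 'rV[F]_n) : L (@r2v _ C u) = (l *m u^T) 0 0.
  rewrite r2vE (scalar_sum _ _ lL) !mxE.
  by apply: eq_bigr => i _; rewrite !mxE mulrC.
have BE (u w : 'rV[F]_n) : B (@r2v _ C u) (@r2v _ C w) = (u *m G *m w^T) 0 0.
  rewrite (r2vE w) (scalar_sum _ _ (lB _)) mxE; apply: eq_bigr => j _.
  rewrite !mxE mulrC; congr (_ * _).
  rewrite r2vE (scalar_sum _ _ (rB _)); apply: eq_bigr => i _.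
  by rewrite mxE.
have /submxP[u lu] : (l <= G)%MS.
  rewrite submxE; apply/eqP/matrixP => i j; rewrite ord1 [RHS]mxE.
  pose w := (col j (cokermx G))^T.
  have wT : w^T = cokermx G *m delta_mx j 0 by rewrite trmxK colE.
  have := BL (@r2v _ C w); rewrite BE LE wT -mulmxA (mulmxA G) mulmx_coker.
  by rewrite mul0mx mulmx0 mulmxA -colE !mxE; exact.
exists (@r2v _ C u) => c'; rewrite -[c']v2rK BE LE lu //.
Qed.

(** * Integrals over faces *)

Section facets.
Context {R : realType} {d : nat}.
Implicit Types (e : @facet R d) (g h : 'rV[R]_d -> R).

Definition face_integrable e g : Prop :=
  (leb R d.-1).-integrable (fdom e) (fun y => (g (fchart e y))%:E).

Lemma fchart_face_set e y : fdom e y -> face_set e (fchart e y).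
Proof. by exists y. Qed.

Lemma eq_fint e g h : (forall x, face_set e x -> g x = h x) ->
  fint e g = fint e h.
Proof.
move=> gh; apply: eq_Rintegral => y /set_mem ey.
by rewrite gh//; exact: fchart_face_set.
Qed.

Lemma eq_face_integrable e g h : (forall x, face_set e x -> g x = h x) ->
  face_integrable e g -> face_integrable e h.
Proof.
move=> gh; apply: eq_integrable; first exact: polytope_measurable (fdom_polytope e).
by move=> y /set_mem ey; rewrite gh//; exact: fchart_face_set.
Qed.

Lemma fintZ e a g : face_integrable e g ->
  fint e (fun x => a * g x) = a * fint e g.
Proof.
by move=> ig; rewrite /fint RintegralZl//; exact: polytope_measurable (fdom_polytope e).
Qed.

Lemma face_integrableZ e a g : face_integrable e g ->
  face_integrable e (fun x => a * g x).
Proof.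
move=> ig; have me := polytope_measurable (fdom_polytope e).
by rewrite /face_integrable; under eq_fun do rewrite EFinM; exact: integrableZl.
Qed.

Lemma fint_linear e a g h : face_integrable e g -> face_integrable e h ->
  fint e (fun x => a * g x + h x) = a * fint e g + fint e h.
Proof.
move=> ig ih; have me := polytope_measurable (fdom_polytope e).
rewrite -fintZ// /fint RintegralD//; exact: face_integrableZ.
Qed.

Lemma polyfun_fchart e g : polyfun g -> polyfun (g \o fchart e).
Proof.
apply: polyfun_comp => i; rewrite /fchart.
under eq_fun do rewrite mxE mxE; apply: polyfunD; first exact: polyfun_cst.
apply: polyfun_sum => j _; apply: polyfunM; first exact: polyfun_coord.
exact: polyfun_cst.
Qed.

Lemma polyfun_face_integrable e g : polyfun g -> face_integrable e g.
Proof.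
move=> pg; apply: (polyfun_integrable (fdom_polytope e) (polyfun_fchart _ pg)).
Qed.

(** The polynomial [h] is bounded by some [K] on the face and [|g| <= 1 + g^2], so [K (1 + g^2)] is
    an integrable majorant. *)
Lemma L2_face_integrable e g h :
  square_integrable (fdom e) (g \o fchart e) -> polyfun h ->
  face_integrable e (fun x => g x * h x).
Proof.
move=> [mg ig] ph; have pe := fdom_polytope e; have me := polytope_measurable pe.
have ph' := polyfun_fchart e ph.
have [_ be _ _ _] := pe; have [K hK] := polyfun_bounded ph' be.
apply: (@le_integrable _ _ _ _ _ me _
  (fun y => K%:E * (1 + ((g (fchart e y)) ^+ 2)%:E))%E).
- apply/measurable_EFinP; apply: measurable_funM => //.
  by apply: measurable_funTS; exact: polyfun_measurable.
- move=> y ey; rewrite -EFinD -EFinM /= lee_fin !normrM mulrC.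
  apply: ler_pM => //; first exact: le_trans (hK _ ey) (ler_norm K).
  rewrite [leRHS]ger0_norm ?addr_ge0 ?sqr_ge0//.
  set t := g _; rewrite -real_normK ?num_real//; set s := `|t|.
  by have := sqr_ge0 (s - 1); have := normr_ge0 t; rewrite -/s; nra.
- apply: integrableZl => //; apply: integrableD => //.
  exact: (polyfun_integrable pe (polyfun_cst _ 1)).
Qed.

Lemma face_integrable_sum e (I : Type) (r : seq I) (G : I -> 'rV[R]_d -> R) :
  (forall i, face_integrable e (G i)) ->
  face_integrable e (fun x => \sum_(i <- r) G i x).
Proof.
move=> iG; have me := polytope_measurable (fdom_polytope e).
rewrite /face_integrable; under eq_fun do rewrite -sumEFin.
by apply: integrable_sum => // i _; exact: iG.
Qed.

Lemma fint_eq0 e g : polyfun g -> (forall x, 0 <= g x) -> fint e g = 0 ->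
  forall x, face_set e x -> g x = 0.
Proof.
move=> pg g0 Ig _ [y ey <-].
exact: (Rintegral_eq0 (fdom_polytope e) (polyfun_fchart e pg)
  (fun=> g0 _) Ig ey).
Qed.

End facets.

(** * Dot products and outward normals *)

Section dot_product.
Context {R : realType} {n : nat}.
Implicit Types (u v w : 'rV[R]_n).

Lemma dotvC u v : dotv u v = dotv v u.
Proof. by apply: eq_bigr => i _; rewrite mulrC. Qed.

Lemma dotvDl u v w : dotv (u + v) w = dotv u w + dotv v w.
Proof. by rewrite -big_split; apply: eq_bigr => i _; rewrite mxE mulrDl. Qed.

Lemma dotvZl a u w : dotv (a *: u) w = a * dotv u w.
Proof. by rewrite mulr_sumr; apply: eq_bigr => i _; rewrite mxE mulrA. Qed.

Lemma dotvNl u w : dotv (- u) w = - dotv u w.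
Proof. by rewrite -scaleN1r dotvZl mulN1r. Qed.

Lemma dotvNr u w : dotv w (- u) = - dotv w u.
Proof. by rewrite dotvC dotvNl dotvC. Qed.

Lemma dotv0l w : dotv 0 w = 0.
Proof. by apply: big1 => i _; rewrite mxE mul0r. Qed.

Lemma dotv_ge0 u : 0 <= dotv u u.
Proof. by apply: sumr_ge0 => i _; rewrite -expr2 sqr_ge0. Qed.

Lemma dotv_eq0 u : dotv u u = 0 -> u = 0.
Proof.
move=> u0; apply/rowP => i; rewrite mxE; apply/eqP; rewrite -sqrf_eq0 expr2.
apply/eqP; move: i isT; apply: psumr_eq0P u0 => i _.
by rewrite -expr2 sqr_ge0.
Qed.

Lemma dotv_unit u : enorm u = 1 -> dotv u u = 1.
Proof. by move=> u1; rewrite -[LHS]sqr_sqrtr ?dotv_ge0// -/(enorm u) u1 expr1n. Qed.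

Lemma polyfun_dotv_shift x u : polyfun (fun y => dotv (y - x) u).
Proof.
apply: polyfun_sum => i _; apply: polyfunM; last exact: polyfun_cst.
under eq_fun do rewrite mxE; apply: polyfunD; last exact: polyfun_cst.
exact: polyfun_coord.
Qed.

Lemma outward_normal_near (A A' : set 'rV[R]_n) x u :
  (\forall y \near x, A y <-> A' y) ->
  outward_normal A x u -> outward_normal A' x u.
Proof.
move=> AA' [u1 xA]; split=> //.
by apply: filterS2 AA' xA => y AA'; rewrite AA'.
Qed.

(** The open half-space is a neighbourhood of each of its points, and [A] agrees with the closed
    half-space near every point close to [x]. *)
Lemma outward_normal_interior (A : set 'rV[R]_n) x u : outward_normal A x u ->
  \forall y \near x, dotv (y - x) u < 0 -> interior A y.
Proof.
move=> [_ /nbhs_interior]; apply: filterS => y yA yu.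
have : \forall z \near y, dotv (z - x) u < 0.
  exact: (polyfun_continuous (polyfun_dotv_shift x u) (lt_nbhsl yu)).
apply: filterS2 yA => z zA zu; exact/zA/ltW.
Qed.

(* Unless v = - u, the direction -(u + v) points strictly inside both half-spaces. *)
Lemma outward_normal_opp (A B : set 'rV[R]_n) x u v :
  interior A `&` interior B = set0 ->
  outward_normal A x u -> outward_normal B x v -> v = - u.
Proof.
move=> AB0 nA nB; apply: contrapT => vu.
have u1 := dotv_unit nA.1; have v1 := dotv_unit nB.1.
pose w := - (u + v).
(* For unit vectors the squared norm of [u + v] is [2 (1 + u.v)], which vanishes only for [v = - u];
   moreover [w.u = w.v = - (1 + u.v)]. *)
have uv0 : 0 < 1 + dotv u v.
  have : 0 < dotv (u + v) (u + v).
    rewrite lt_neqAle dotv_ge0 andbT eq_sym; apply/eqP => /dotv_eq0 uv.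
    by apply: vu; apply/eqP; rewrite -addr_eq0 addrC uv.
  by rewrite dotvDl ![dotv _ (u + v)]dotvC !dotvDl u1 v1 (dotvC v u); lra.
have wu : dotv w u < 0 by rewrite dotvNl dotvDl u1 (dotvC v); lra.
have wv : dotv w v < 0 by rewrite dotvNl dotvDl v1; lra.
have cw : (fun t : R => x + t *: w) @ 0^'+ --> x.
  rewrite -[X in _ --> X]addr0 -(scale0r w).
  apply: cvgD; first exact: cvg_cst.
  by apply: cvgZr_tmp; apply: cvg_at_right_filter; exact: cvg_id.
have nAB : \forall y \near x, (dotv (y - x) u < 0 -> interior A y) /\
    (dotv (y - x) v < 0 -> interior B y).
  apply: filterS2 (outward_normal_interior nA) (outward_normal_interior nB).
  by move=> y.
have t0 : \forall t \near 0^'+, 0 < (t : R) by exact: nbhs_right_gt.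
have cwAB : \forall t \near 0^'+, (dotv (x + t *: w - x) u < 0 ->
    interior A (x + t *: w)) /\ (dotv (x + t *: w - x) v < 0 ->
    interior B (x + t *: w)) by exact: (cw _ nAB).
have [t [[ntA ntB] {}t0]] := filter_ex (filterI cwAB t0).
have : (interior A `&` interior B) (x + t *: w).
  split; [apply: ntA|apply: ntB]; rewrite addrC addKr dotvZl;
  by rewrite pmulr_rlt0.
by rewrite AB0.
Qed.

End dot_product.

(** * Normals of a mesh and cancellation of interior fluxes *)

Section mesh_normals.
Context {R : realType} {d : nat} {Om : set 'rV[R]_d} (M : mesh Om).
Implicit Types (T : elt M) (e : face M).

Lemma eface_sub T e : eface T e -> face_set (facetof e) `<=` cell T.
Proof.
move=> /asboolP[eT _] x /eT[+ _]; exact: polytope_closed (cell_polytope T) x.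
Qed.

Lemma relint_nonempty e : exists x, relint (facetof e) x.
Proof.
have [_ _ [y ey] _ _] := fdom_polytope (facetof e).
by exists (fchart (facetof e) y); exists y.
Qed.

Lemma relint_sub e : relint (facetof e) `<=` face_set (facetof e).
Proof. by move=> _ [y ey <-]; exists y => //; exact: interior_subset. Qed.

Lemma nTP T e x : eface T e -> relint (facetof e) x ->
  outward_normal (cell T) x (nT T e).
Proof.
move=> /asboolP[_ ne] ex.
have := @xgetPex _ 0 [set nu | forall x, relint (facetof e) x ->
  outward_normal (cell T) x nu] ne.
exact.
Qed.

(* A cell T' through x has x on one of its own faces e', as the interiors of cells
   are disjoint, and faces other than e miss the relative interior of e. *)
Lemma relint_away e T T' x : eface T e -> relint (facetof e) x -> T != T' ->
  ~~ eface T' e -> \forall y \near x, ~ cell T' y.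
Proof.
move=> Te ex TT' nT'e.
have xT : cell T x by exact/(eface_sub Te)/relint_sub.
have cT' := polytope_closed (cell_polytope T').
suff xT' : ~ cell T' x by exact: (closed_openC cT').
move=> xT'; have [iT'x|nx] := pselect (interior (cell T') x).
  (* As [x] is in the closure of the interior of [T], the interior of [T'] around [x] would meet
     that interior. *)
  have [clT _ _ _ _] := cell_polytope T.
  move: xT; rewrite -clT => /(_ (interior (cell T'))) [|z zTT'].
    by apply: nbhs_interior.
  by have := cell_disjoint TT'; rewrite -subset0 => /(_ z zTT').
have : frontier (cell T') x by split=> //; exact: subset_closure.
rewrite cell_frontier => -[e' /= T'e' xe'].
have [ee'|ee'] := eqVneq e e'.
  by move/negP: nT'e; apply; apply/asboolP; rewrite ee'.
by have := face_disjoint ee'; rewrite -subset0 => /(_ x (conj ex xe')).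
Qed.

Lemma nT_opp T T' e : eface T e -> eface T' e -> T != T' ->
  nT T' e = - nT T e.
Proof.
move=> Te T'e TT'; have [x ex] := relint_nonempty e.
exact: outward_normal_opp (cell_disjoint TT') (nTP Te ex) (nTP T'e ex).
Qed.

(** Near a point of the relative interior of [e] no other cell occurs, and [closure Om] is the union
    of the cells, so it coincides there with [cell T]. *)
Lemma nT_boundary T e : eface T e -> (forall T', eface T' e -> T' = T) ->
  nT T e = nGamma e.
Proof.
move=> Te Tu.
have near_eq x : relint (facetof e) x ->
    \forall y \near x, cell T y <-> closure Om y.
  move=> ex.
  have : \forall y \near x, forall T', T' != T -> ~ cell T' y.
    (* The cells are finitely many, so the neighbourhoods avoiding each of them can be
       intersected. *)
    have away T' : \forall y \near x, T' != T -> ~ cell T' y.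
      have [->|T'T] := eqVneq T' T; last first.
        have nT' : ~~ eface T' e by apply: contra T'T => /Tu ->.
        have TT' : T != T' by rewrite eq_sym.
        by apply: filterS (relint_away Te ex TT' nT') => y.
      by apply: (@filterE _ _ (nbhs_filter x)) => y /eqP.
    exact: filter_forall away.
  apply: filterS => y yT'; rewrite -(cell_cover M); split=> [Ty|[T' _ T'y]].
    by exists T.
  by have [<-//|/yT'] := eqVneq T' T.
(* Both normals are then chosen by [xget] from the same set. *)
rewrite /nT /nGamma /normal; congr xget; apply/seteqP; split=> nu nnu x ex.
  exact: outward_normal_near (near_eq x ex) (nnu x ex).
apply: outward_normal_near (nnu x ex).
by apply: filterS (near_eq x ex) => y [].
Qed.

(** Once the sums are exchanged, [face_owners] leaves one term on a boundary face and two on any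
    other; the latter cancel because [g e] is common to both sides. *)
Lemma flux_telescope (g : face M -> 'rV[R]_d -> 'rV[R]_d) :
  (forall e i, face_integrable (facetof e) (fun x => g e x 0 i)) ->
  \sum_(T : elt M) \sum_(e | eface T e)
     faceint e (fun x => dotv (g e x) (nT T e)) =
  \sum_(e : face M | bface e) faceint e (fun x => dotv (g e x) (nGamma e)).
Proof.
move=> ig; rewrite (exchange_big_dep predT)//= [RHS]big_mkcond/=.
apply: eq_bigr => e _; have owners := face_owners e.
case: ifPn => [be|nbe].
  have [[_ /eqP/cards1P[T eT]]|[nb _]] := owners; last first.
    by move/asboolP: be.
  have Te T' : eface T' e = (T' == T).
    by have := congr1 (fun s : {set elt M} => T' \in s) eT; rewrite !inE.
  under eq_bigl do rewrite Te; rewrite big_pred1_eq (@nT_boundary T)//.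
    by rewrite Te.
  by move=> T'; rewrite Te => /eqP.
have [[b _]|[_ /eqP/cards2P[T [T' [TT' eT]]]]] := owners.
  by move/negP: nbe; case; apply/asboolP.
have Te T'' : eface T'' e = (T'' == T) || (T'' == T').
  by have := congr1 (fun s : {set elt M} => T'' \in s) eT; rewrite !inE.
rewrite (bigD1 T) ?Te ?eqxx//= (big_pred1 T'); last first.
  move=> T''; rewrite Te; have [->|] := eqVneq T'' T; first by rewrite /= (negPf TT').
  by rewrite andbT.
rewrite (@nT_opp T T') ?Te ?eqxx ?orbT//.
have iT : face_integrable (facetof e) (fun x => dotv (g e x) (nT T e)).
  apply: face_integrable_sum => i; under eq_fun do rewrite mulrC.
  exact: face_integrableZ.
under [X in _ + faceint e X]eq_fun do rewrite dotvNr -mulN1r.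
by rewrite /faceint fintZ// mulN1r subrr.
Qed.

End mesh_normals.

(** * Polynomial spaces as images of finite-dimensional coefficient spaces *)

Section polynomial_spaces.
Context {R : realType} {d : nat}.
Local Notation X := 'rV[R]_d.
Local Notation coefs r := {ffun {ffun 'I_d -> 'I_r.+1} -> R^o}.

(** The coefficients form a [vectType], to which [riesz] applies. The map to functions need not be
    injective, since exponents of total degree above [r] are left out of the sum. *)
Definition polyval r (c : coefs r) (x : X) : R :=
  \sum_(m : {ffun 'I_d -> 'I_r.+1} | (\sum_i m i <= r)%N)
    c m * \prod_i x 0 i ^+ m i.

Lemma is_poly_polyval r (c : coefs r) : is_poly r (polyval c).
Proof. by exists c. Qed.

Lemma is_polyP r (p : X -> R) : is_poly r p -> exists c : coefs r, p = polyval c.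
Proof.
move=> [c pE]; exists (finfun c); apply/funext => x; rewrite pE.
by apply: eq_bigr => m _; rewrite ffunE.
Qed.

Lemma polyval_linear r a (c c' : coefs r) x :
  polyval (a *: c + c') x = a * polyval c x + polyval c' x.
Proof.
rewrite mulr_sumr -big_split; apply: eq_bigr => m _.
by rewrite !ffunE mulrDl mulrA.
Qed.

Lemma polyfun_polyval r (c : coefs r) : polyfun (polyval c).
Proof. exact/is_poly_polyfun/is_poly_polyval. Qed.

Lemma is_poly_linear r a (p q : X -> R) : is_poly r p -> is_poly r q ->
  is_poly r (fun x => a * p x + q x).
Proof.
move=> /is_polyP[c ->] /is_polyP[c' ->].
under eq_fun do rewrite -polyval_linear; exact: is_poly_polyval.
Qed.

Lemma is_poly_cst r (a : R) : is_poly r ((fun=> a) : X -> R).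
Proof.
pose c : coefs r := [ffun m => a *+ (m == [ffun=> ord0])].
rewrite (_ : (fun=> _) = polyval c); first exact: is_poly_polyval.
apply/funext => x; rewrite /polyval (bigD1 [ffun=> ord0]) /=; last first.
  by rewrite big1// => i _; rewrite ffunE.
rewrite ffunE eqxx big1 => [|i _]; last by rewrite ffunE expr0.
rewrite mulr1 big1 ?addr0// => m /andP[_ /negPf m0].
by rewrite ffunE m0 mul0r.
Qed.

Lemma polyfun_grad (p : X -> R) i : polyfun p -> polyfun (fun x => grad p x 0 i).
Proof. by move=> pp; under eq_fun do rewrite mxE; exact: polyfun_derive. Qed.

Lemma grad_polyval_linear r a (c c' : coefs r) x :
  grad (polyval (a *: c + c')) x = a *: grad (polyval c) x + grad (polyval c') x.
Proof.
apply/rowP => i; rewrite !mxE /partial.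
rewrite (_ : polyval (a *: c + c') = a \*: polyval c + polyval c'); last first.
  by apply/funext => y; exact: polyval_linear.
rewrite deriveD ?deriveZ//; first exact: polyfun_derivable (polyfun_polyval _).
  by apply: derivableZ; exact: polyfun_derivable (polyfun_polyval _).
exact: polyfun_derivable (polyfun_polyval _).
Qed.

Lemma polyfun_dotv (g h : X -> X) : (forall i, polyfun (fun x => g x 0 i)) ->
  (forall i, polyfun (fun x => h x 0 i)) -> polyfun (fun x => dotv (g x) (h x)).
Proof. by move=> pg ph; apply: polyfun_sum => i _; exact: polyfunM. Qed.

(* V_{k-1}(e) is parametrized linearly: c.1.1 gives the polynomial part, c.1.2 the
   translation and c.2 - c.2^T, for an arbitrary matrix c.2, the skew matrix. *)
Definition vecval r (c : {ffun 'I_d -> coefs r} * 'rV[R]_d * 'M[R]_d) (x : X) : X :=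
  \row_i polyval (c.1.1 i) x + (c.1.2 + x *m (c.2 - c.2^T)).

Lemma vecval_linear r a (c c' : {ffun 'I_d -> coefs r} * 'rV[R]_d * 'M[R]_d) x :
  vecval (a *: c + c') x = a *: vecval c x + vecval c' x.
Proof.
rewrite /vecval /=.
have -> : a *: c.2 + c'.2 - (a *: c.2 + c'.2)^T =
    a *: (c.2 - c.2^T) + (c'.2 - c'.2^T).
  by apply/matrixP => i j; rewrite !mxE; ring.
rewrite mulmxDr -scalemxAr; apply/rowP => i; rewrite !mxE !ffunE polyval_linear.
by ring.
Qed.

Lemma polyfun_vecval r (c : {ffun 'I_d -> coefs r} * 'rV[R]_d * 'M[R]_d) i :
  polyfun (fun x => vecval c x 0 i).
Proof.
under eq_fun do rewrite 4!mxE; apply: polyfunD; first exact: polyfun_polyval.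
apply: polyfunD; first exact: polyfun_cst.
apply: polyfun_sum => j _; apply: polyfunM; first exact: polyfun_coord.
exact: polyfun_cst.
Qed.

Context {Om : set X} (M : mesh Om).
Implicit Types (T : elt M) (e : face M) (k : nat).

Lemma VfaceP k e g : Vface k e g <->
  exists c : {ffun 'I_d -> coefs k.-1} * 'rV[R]_d * 'M[R]_d,
    forall x, face_set (facetof e) x -> g x = vecval c x.
Proof.
split=> [[p [r [pp [a [eta [skew rE]]] gE]]]|[c gE]].
  have /choice[c pc] : forall i, exists c : coefs k.-1,
      (fun x => p x 0 i) = polyval c by move=> i; exact/is_polyP/pp.
  (* Since [eta] is skew, half of [eta^T] minus its own transpose is [eta^T] again. *)
  exists (finfun c, a, 2^-1 *: eta^T) => x ex.
  rewrite gE// rE /vecval/=.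
  have -> : 2^-1 *: eta^T - (2^-1 *: eta^T)^T = eta^T.
    apply/matrixP => i j; rewrite !mxE.
    by have := congr1 (fun A : 'M[R]_d => A i j) skew; rewrite !mxE => ->; lra.
  have -> // : \row_i polyval (finfun c i) x = p x.
  by apply/rowP => i; rewrite mxE ffunE -pc.
exists (fun x => \row_i polyval (c.1.1 i) x).
exists (fun x => c.1.2 + x *m (c.2 - c.2^T)); split=> //.
  by move=> i; under eq_fun do rewrite mxE; exact: is_poly_polyval.
exists c.1.2, (c.2 - c.2^T)^T; rewrite trmxK; split=> //.
by apply/matrixP => i j; rewrite !mxE; ring.
Qed.

End polynomial_spaces.

(** * Existence of the weak divergence and of the face projection, and total flux *)

Section weak_divergence.
Context {R : realType} {d : nat} {Om : set 'rV[R]_d} (M : mesh Om).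
Implicit Types (T : elt M) (e : face M) (k : nat) (v : wfun M).

Lemma eq_cellint T g h : (forall x, cell T x -> g x = h x) ->
  cellint T g = cellint T h.
Proof. by move=> gh; apply: eq_Rintegral => x /set_mem; exact: gh. Qed.

Lemma cellint0 T : cellint T (fun=> 0) = 0.
Proof. by rewrite /cellint /Rintegral integral0. Qed.

Lemma fint0 (e : @facet R d) : fint e (fun=> 0) = 0.
Proof. by rewrite /fint /Rintegral integral0. Qed.

Lemma cellintZ T a g : polyfun g -> cellint T (fun x => a * g x) = a * cellint T g.
Proof.
move=> pg; rewrite /cellint RintegralZl//.
  exact: polytope_measurable (cell_polytope T).
exact: polyfun_integrable (cell_polytope T) pg.
Qed.

Lemma cellint_linear T a g h : polyfun g -> polyfun h ->
  cellint T (fun x => a * g x + h x) = a * cellint T g + cellint T h.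
Proof.
move=> pg ph; rewrite -cellintZ// /cellint RintegralD//.
- exact: polytope_measurable (cell_polytope T).
- apply: (polyfun_integrable (cell_polytope T)).
  exact: polyfunM (polyfun_cst _ _) pg.
- exact: polyfun_integrable (cell_polytope T) ph.
Qed.

Lemma cellint_sqr_eq0 T g : polyfun g -> cellint T (fun x => g x * g x) = 0 ->
  forall x, cell T x -> g x = 0.
Proof.
move=> pg Ig x Tx.
have gg0 y : 0 <= g y * g y by rewrite -expr2 sqr_ge0.
have := Rintegral_eq0 (cell_polytope T) (polyfunM pg pg) gg0 Ig Tx.
by rewrite -expr2 => /eqP; rewrite sqrf_eq0 => /eqP.
Qed.

(** At interior points [p] vanishes in a neighbourhood, and so does its gradient there; continuity
    carries this to the whole cell. *)
Lemma grad_eq0 T (p : 'rV[R]_d -> R) : polyfun p ->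
  (forall x, cell T x -> p x = 0) -> forall x, cell T x -> grad p x = 0.
Proof.
move=> pp p0 x Tx; apply/rowP => i; rewrite [RHS]mxE.
move: x Tx; apply: (eq0_on_polytope (cell_polytope T)) => [|x xT].
  exact: polyfun_continuous (polyfun_grad _ pp).
rewrite mxE /partial (@near_eq_derive _ _ _ p (cst 0)) ?derive_cst//.
by apply: filterS xT => y; exact: p0.
Qed.

(** Values off the face are arbitrary, so integrability is obtained from a polynomial that agrees
    with [g] on the face. *)
Lemma Vface_polyfun k e g : Vface k e g ->
  exists h : 'rV[R]_d -> 'rV[R]_d, (forall i, polyfun (fun x => h x 0 i)) /\
    forall x, face_set (facetof e) x -> g x = h x.
Proof.
move=> /VfaceP[c gc]; exists (vecval c); split=> // i; exact: polyfun_vecval.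
Qed.

(** The default value of [xget] is the zero function, itself a polynomial. *)
Lemma wdiv_poly k v T : is_poly k.-1 (wdiv k v T).
Proof. by rewrite /wdiv; case: xgetP => [g -> []//|_]; exact: is_poly_cst. Qed.

Lemma polyfun_wdiv k v T : polyfun (wdiv k v T).
Proof. exact: is_poly_polyfun (wdiv_poly k v T). Qed.

(** [riesz] is applied on coefficients, with the L2 product over the cell as [B] and the right-hand
    side as [L]. *)
Lemma wdivP k v T phi : Vh k v -> is_poly k.-1 phi ->
  cellint T (fun x => wdiv k v T x * phi x) =
  - cellint T (fun x => dotv (w0 v T x) (grad phi x)) +
  \sum_(e | eface T e) faceint e (fun x => dotv (wb v e x) (nT T e) * phi x).
Proof.
move=> [v0 vb] pphi; rewrite /wdiv.
set A := [set g | _]; suff /(xgetPex (fun=> 0)) [_] : exists g, A g by apply.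
move=> {phi pphi}; rewrite /A.
have pv0 i : polyfun (fun x => w0 v T x 0 i) by exact: is_poly_polyfun (v0 T i).
pose L (c : {ffun {ffun 'I_d -> 'I_k.-1.+1} -> R^o}) :=
  - cellint T (fun x => dotv (w0 v T x) (grad (polyval c) x)) +
  \sum_(e | eface T e)
    faceint e (fun x => dotv (wb v e x) (nT T e) * polyval c x).
pose B (c c' : {ffun {ffun 'I_d -> 'I_k.-1.+1} -> R^o}) :=
  cellint T (fun x => polyval c x * polyval c' x).
have [||||c cL] := @riesz R _ B L; rewrite /B.
- move=> c a c1 c2; rewrite -cellint_linear.
  + by apply: eq_cellint => x _; rewrite polyval_linear; ring.
  + by apply: polyfunM; exact: polyfun_polyval.
  + by apply: polyfunM; exact: polyfun_polyval.
- move=> c a c1 c2; rewrite -cellint_linear.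
  + by apply: eq_cellint => x _; rewrite polyval_linear; ring.
  + by apply: polyfunM; exact: polyfun_polyval.
  + by apply: polyfunM; exact: polyfun_polyval.
- move=> a c c'; rewrite /L.
  have -> : cellint T (fun x => dotv (w0 v T x) (grad (polyval (a *: c + c')) x)) =
      a * cellint T (fun x => dotv (w0 v T x) (grad (polyval c) x)) +
      cellint T (fun x => dotv (w0 v T x) (grad (polyval c') x)).
    rewrite -cellint_linear.
    - apply: eq_cellint => x _.
      by rewrite grad_polyval_linear !(dotvC (w0 v T x)) dotvDl dotvZl.
    - by apply: polyfun_dotv => // i; exact: polyfun_grad (polyfun_polyval _).
    - by apply: polyfun_dotv => // i; exact: polyfun_grad (polyfun_polyval _).
  have -> : \sum_(e | eface T e) faceint e
        (fun x => dotv (wb v e x) (nT T e) * polyval (a *: c + c') x) =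
      a * (\sum_(e | eface T e)
        faceint e (fun x => dotv (wb v e x) (nT T e) * polyval c x)) +
      \sum_(e | eface T e)
        faceint e (fun x => dotv (wb v e x) (nT T e) * polyval c' x).
    rewrite mulr_sumr -big_split; apply: eq_bigr => e _ /=.
    have iv c1 : face_integrable (facetof e)
        (fun x => dotv (wb v e x) (nT T e) * @polyval R d k.-1 c1 x).
      have [h [ph vh]] := Vface_polyfun (vb e).
      apply: (@eq_face_integrable _ _ _
        (fun x => dotv (h x) (nT T e) * polyval c1 x)) => [x ex|].
        by rewrite vh.
      apply: polyfun_face_integrable; apply: polyfunM (polyfun_polyval _).
      by apply: polyfun_dotv => // i; exact: polyfun_cst.
    rewrite /faceint -fint_linear//; apply: eq_fint => x _.
    by rewrite polyval_linear; ring.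
  by rewrite opprD addrACA -mulrN -mulrDr.
(* An isotropic [c] gives a polynomial that is zero on the cell, hence with zero gradient there and
   zero values on the faces, so both parts of [L] vanish. *)
- move=> c /cellint_sqr_eq0 c0; have {}c0 := c0 (polyfun_polyval c).
  rewrite /L (@eq_cellint _ _ (fun=> 0)); last first.
    move=> x Tx; rewrite (grad_eq0 (polyfun_polyval c) c0 Tx).
    by rewrite dotvC dotv0l.
  rewrite cellint0 oppr0 add0r big1// => e Te.
  rewrite /faceint (@eq_fint _ _ _ _ (fun=> 0)); first exact: fint0.
  by move=> x /(eface_sub Te)/c0 ->; rewrite mulr0.
exists (polyval c); split; first exact: is_poly_polyval.
by move=> _ /is_polyP[c' ->]; exact: cL.
Qed.

(** Again by [riesz], now with the L2 product over the face: an isotropic parameter gives a field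
    that is zero on the face, on which the functional vanishes. *)
Lemma QbP k e (g : 'rV[R]_d -> 'rV[R]_d) w :
  (forall i, square_integrable (fdom (facetof e))
     (fun y => g (fchart (facetof e) y) 0 i)) -> Vface k e w ->
  faceint e (fun x => dotv (Qb k e g x) (w x)) =
  faceint e (fun x => dotv (g x) (w x)).
Proof.
move=> g2 Vw; rewrite /Qb.
set A := [set q | _]; suff /(xgetPex (fun=> 0)) [_] : exists q, A q by apply.
move=> {w Vw}; rewrite /A.
pose C : vectType R :=
  ({ffun 'I_d -> {ffun {ffun 'I_d -> 'I_k.-1.+1} -> R^o}} * 'rV[R]_d * 'M[R]_d)%type.
pose vv : C -> 'rV[R]_d -> 'rV[R]_d := @vecval R d k.-1.
have pvv c i : polyfun (fun x => vv c x 0 i) by exact: polyfun_vecval.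
have ivv c c' : face_integrable (facetof e) (fun x => dotv (vv c x) (vv c' x)).
  exact/polyfun_face_integrable/polyfun_dotv.
have igv c : face_integrable (facetof e) (fun x => dotv (g x) (vv c x)).
  apply: face_integrable_sum => i; exact: L2_face_integrable (g2 i) (pvv c i).
have vvl a c c' x : vv (a *: c + c') x = a *: vv c x + vv c' x.
  exact: vecval_linear.
have [||||c cL] := @riesz R C
  (fun c c' => faceint e (fun x => dotv (vv c x) (vv c' x)))
  (fun c => faceint e (fun x => dotv (g x) (vv c x))).
- move=> c a c1 c2; rewrite /faceint -fint_linear//; apply: eq_fint => x _.
  by rewrite !(dotvC (vv c x)) vvl dotvDl dotvZl.
- move=> c a c1 c2; rewrite /faceint -fint_linear//; apply: eq_fint => x _.
  by rewrite vvl dotvDl dotvZl.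
- move=> a c c'; rewrite /faceint -fint_linear//; apply: eq_fint => x _.
  by rewrite !(dotvC (g x)) vvl dotvDl dotvZl.
- move=> c c0; rewrite /faceint (@eq_fint _ _ _ _ (fun=> 0)); first exact: fint0.
  move=> x ex; rewrite (_ : vv c x = 0); first by rewrite dotvC dotv0l.
  apply: dotv_eq0; move: x ex; apply: fint_eq0 c0.
    exact: polyfun_dotv.
  by move=> x; exact: dotv_ge0.
exists (vv c); split; first by apply/VfaceP; exists c.
move=> w /VfaceP[c' wc']; rewrite /faceint.
rewrite (@eq_fint _ _ _ _ (fun x => dotv (vv c x) (vv c' x))); last first.
  by move=> x ex; rewrite wc'.
rewrite [LHS]cL; apply: eq_fint => x ex; by rewrite wc'.
Qed.

Lemma Vface_cst k e (a : 'rV[R]_d) : Vface k e (fun=> a).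
Proof.
exists (fun=> a), (fun=> 0); split=> [i||x _]; last by rewrite addr0.
  exact: is_poly_cst.
by exists 0, 0; split=> [|x]; rewrite ?trmx0 ?oppr0// mulmx0 addr0.
Qed.

Lemma wdiv_flux k v uhat : Vh k v -> L2_boundary M uhat ->
  boundary_data k uhat v ->
  \sum_(T : elt M) cellint T (wdiv k v T) = boundary_flux M uhat.
Proof.
move=> vV huhat bv.
have iwb e i : face_integrable (facetof e) (fun x => wb v e x 0 i).
  have [h [ph vh]] := Vface_polyfun (vV.2 e).
  apply: (@eq_face_integrable _ _ _ (fun x => h x 0 i)) => [x ex|].
    by rewrite vh.
  exact: polyfun_face_integrable.
transitivity (\sum_(T : elt M) \sum_(e | eface T e)
    faceint e (fun x => dotv (wb v e x) (nT T e))).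
  apply: eq_bigr => T _; have := wdivP T vV (is_poly_cst k.-1 1).
  rewrite (@eq_cellint _ _ (wdiv k v T)); last by move=> x _; rewrite mulr1.
  move=> ->; rewrite (@eq_cellint _ _ (fun=> 0)); last first.
    move=> x _; rewrite (_ : grad _ x = 0); first by rewrite dotvC dotv0l.
    by apply/rowP => i; rewrite !mxE /partial derive_cst.
  rewrite cellint0 oppr0 add0r; apply: eq_bigr => e _.
  by apply: eq_fint => x _; rewrite mulr1.
rewrite flux_telescope//; apply: eq_bigr => e be.
(* The face is flat with a single normal, a constant test field, so the projection can be put in
   front of [uhat]. *)
rewrite -(QbP (huhat e be) (Vface_cst k e (nGamma e))).
by apply: eq_fint => x ex; rewrite bv.
Qed.

End weak_divergence.

(** * Elimination of the pressure *)

Section equivalence.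
Context {R : realType} {d : nat} {Om : set 'rV[R]_d} (M : mesh Om).
Context (Om0 : Om !=set0) (k : nat).
Implicit Types (T : elt M) (v : wfun M) (p q : pwfun M).

(** A point of [Om] lies in some cell, and cells have positive volume; mean values are quotients by
    this number. *)
Lemma total_volume_gt0 : 0 < \sum_(T : elt M) cellint T (fun=> 1).
Proof.
have vol T : 0 < cellint T (fun=> 1).
  have pT := cell_polytope T.
  rewrite /cellint (Rintegral_cst _ (polytope_measurable pT)) mul1r.
  by rewrite fine_gt0// polytope_gt0//= polytope_lty.
have [x Ox] := Om0; have : closure Om x by exact: subset_closure.
rewrite -(cell_cover M) => -[T _ _].
rewrite (bigD1 T)//= ltr_wpDr//; apply: sumr_ge0 => T' _; exact: ltW.
Qed.

Lemma polyfun_Wh q T : Wh k q -> polyfun (q T).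
Proof. by move=> qW; exact: is_poly_polyfun (qW T). Qed.

(** For this pressure, [form_b] is the term by which [form_as] exceeds [form_a]. *)
Lemma form_b_lam_wdiv v v' lam :
  form_b k v (fun T x => lam * wdiv k v' T x) =
  \sum_(T : elt M) lam * cellint T (fun x => wdiv k v' T x * wdiv k v T x).
Proof.
apply: eq_bigr => T _; rewrite -cellintZ; last first.
  by apply: polyfunM; exact: polyfun_wdiv.
by apply: eq_cellint => x _; ring.
Qed.

(* Split q into a function of mean zero and a constant c; against c the equation is
   the mean value condition on p. *)
Lemma pressure_eq_Wh u p lam : Wh k p ->
  \sum_(T : elt M) cellint T (wdiv k u T) =
    pw_inner (fun T x => lam^-1 * p T x) (fun _ _ => 1) ->
  (forall q, Wh0 k q -> form_b k u q - lam^-1 * pw_inner p q = 0) ->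
  forall q, Wh k q -> form_b k u q = lam^-1 * pw_inner p q.
Proof.
move=> pW mean_eq eq0 q qW; set V := \sum_(T : elt M) cellint T (fun=> 1).
have V0 : V != 0 by exact: lt0r_neq0 total_volume_gt0.
pose c := (\sum_(T : elt M) cellint T (q T)) / V.
(* The factor 1 gives the shape expected by [is_poly_linear] and [cellint_linear]. *)
pose q0 : pwfun M := fun T x => - c * 1 + q T x.
have q0W : Wh0 k q0.
  split=> [T|]; first exact: is_poly_linear (is_poly_cst _ _) (qW T).
  under eq_bigr => T _ do
    rewrite (cellint_linear T (- c) (polyfun_cst _ 1) (polyfun_Wh T qW)).
  by rewrite big_split/= -mulr_sumr -/V /c mulNr divfK// addNr.
have qE T x : q T x = c * 1 + q0 T x by rewrite /q0; ring.
have pq0 T : polyfun (q0 T) by exact: polyfun_Wh q0W.1.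
have bE : form_b k u q =
    c * \sum_(T : elt M) cellint T (wdiv k u T) + form_b k u q0.
  rewrite mulr_sumr -big_split; apply: eq_bigr => T _ /=.
  rewrite -cellint_linear; [|exact: polyfun_wdiv|].
    by apply: eq_cellint => x _; rewrite qE; ring.
  by apply: polyfunM => //; exact: polyfun_wdiv.
have pE : lam^-1 * pw_inner p q =
    c * pw_inner (fun T x => lam^-1 * p T x) (fun _ _ => 1) +
    lam^-1 * pw_inner p q0.
  rewrite !mulr_sumr -big_split; apply: eq_bigr => T _ /=.
  have pp := polyfun_Wh T pW.
  have pp1 : polyfun (fun x => lam^-1 * p T x * 1).
    exact: polyfunM (polyfunM (polyfun_cst _ _) pp) (polyfun_cst _ _).
  have ppq : polyfun (fun x => p T x * q T x).
    exact: polyfunM pp (polyfun_Wh T qW).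
  have ppq0 : polyfun (fun x => p T x * q0 T x) by exact: polyfunM.
  rewrite -(cellintZ T _ ppq) -(cellintZ T _ ppq0).
  rewrite -(cellint_linear T c pp1 (polyfunM (polyfun_cst _ lam^-1) ppq0)).
  by apply: eq_cellint => x _; rewrite qE; ring.
by rewrite bE pE mean_eq; congr (_ + _); apply/eqP; rewrite -subr_eq0 eq0.
Qed.

End equivalence.

Theorem lemma4p1 (R : realType) (d : nat) (hd : d = 2%N \/ d = 3%N)
    (Om : set 'rV[R]_d) (hOm : polytopal_domain Om)
    (M : mesh Om) (hM : shape_regular M)
    (k : nat) (hk : (1 <= k)%N)
    (mu lam : R) (hmu : 0 < mu) (hlam : 0 < lam)
    (f uhat : 'rV[R]_d -> 'rV[R]_d)
    (hf : L2_domain Om f) (huhat : L2_boundary M uhat)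
    (u : wfun M) :
  primal_solution k mu lam f uhat u <->
  exists p : pwfun M, mixed_solution k mu lam f uhat u p.
Proof.
have Om0 : Om !=set0 by case: hOm.
have lamN0 : lam != 0 by exact: lt0r_neq0 hlam.
split=> [[uV ubd ueq]|[p [[uV pW] ubd pflux peq peq0]]].
  exists (fun T x => lam * wdiv k u T x); split=> //.
  - split=> // T; rewrite (_ : (fun _ => _) = fun x => lam * wdiv k u T x + 0).
      exact: is_poly_linear (wdiv_poly k u T) (is_poly_cst _ _).
    by apply/funext => x; rewrite addr0.
  - rewrite -(wdiv_flux uV huhat ubd); apply: eq_bigr => T _.
    by apply: eq_cellint => x _; rewrite mulKf// mulr1.
  - by move=> v vV; rewrite -ueq// form_b_lam_wdiv.
  (* The equation holds cell by cell, because [lam^-1] cancels the factor of the pressure. *)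
  - move=> q [qW _]; rewrite mulr_sumr; apply/eqP; rewrite subr_eq0; apply/eqP.
    apply: eq_bigr => T _; rewrite -cellintZ.
      by apply: eq_cellint => x _; rewrite -mulrA mulKf.
    apply: polyfunM (polyfun_Wh T qW).
    exact: polyfunM (polyfun_cst _ _) (polyfun_wdiv _ _ _).
split=> // v vV; rewrite -peq// /form_as; congr (_ + _).
have mean_eq := etrans (wdiv_flux uV huhat ubd) (esym pflux).
(* This gives [b(v, p)] as [lam] times the product of the two weak divergences, once multiplied by
   [lam]. *)
have := pressure_eq_Wh Om0 pW mean_eq peq0 (fun T => wdiv_poly k v T).
rewrite -mulr_sumr -/(form_b k u (wdiv k v)) => ->; rewrite mulVKf//.
by apply: eq_bigr => T _; apply: eq_cellint => x _; rewrite mulrC.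
Qed.
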